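(* (Rough Gronwall Lemma) Fix a time horizon $T>0$ and let $G:[0,T]\to[0,\infty)$ be a path such that for some constants $C,L>0$, $\kappa\ge1$ and some controls $\omega_1,\omega_2$ on $[0,T]$ with $\omega_1$ being regular, one has $$\delta G_{st}\le C\Big(\sup_{0\le r\le t}G_r\Big)\,\omega_1(s,t)^{\frac1\kappa}+\omega_2(s,t)$$ for every $s<t\in[0,T]$ satisfying $\omega_1(s,t)\le L$. Then it holds $$\sup_{0\le t\le T}G_t\le 2\exp\Big(\frac{\omega_1(0,T)}{\alpha L}\Big)\cdot\Big\{G_0+\sup_{0\le t\le T}\Big(\omega_2(0,t)\exp\Big(-\frac{\omega_1(0,t)}{\alpha L}\Big)\Big)\Big\},$$ where $\alpha$ is defined as $$\alpha=\min\Big(1,\ \frac{1}{L(2Ce^2)^\kappa}\Big).$$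
   Context: For a path $G$ on $[0,T]$ and $s,t\in[0,T]$, $\delta G_{st}:=G_t-G_s$. A control on an interval $I$ is a map $\omega:\{(s,t)\in I^2:s\le t\}\to[0,\infty)$ that is superadditive, i.e. $\omega(s,u)+\omega(u,t)\le\omega(s,t)$ for all $s\le u\le t$ in $I$. A control is called regular if $\lim_{|t-s|\to0}\omega(s,t)=0$.
   Formalization: G is additionally assumed bounded on [0,T], so that the suprema are finite; if infinite suprema were allowed the claim would fail, e.g. for G_0 = 0, G_t = 1/t, ω_1(s,t) = t − s, ω_2 = 0. *)

(* Defs.v *)
From HB Require Import structures.
From mathcomp Require Import all_boot all_order all_algebra.
From mathcomp Require Import all_classical all_reals all_analysis.
Set Implicit Arguments.
Unset Strict Implicit.
Unset Printing Implicit Defensive.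
Import Order.TTheory GRing.Theory Num.Theory.
Local Open Scope classical_set_scope.
Local Open Scope ring_scope.

Definition increment (R : realType) (G : R -> R) (s t : R) : R := G t - G s.

(* A map on {(s, t) in I^2 | s <= t} is a total function [R -> R -> R] whose
   values off that set are never constrained nor used. *)
Definition is_control (R : realType) (I : interval R) (w : R -> R -> R) : Prop :=
  (forall s t, s \in I -> t \in I -> s <= t -> 0 <= w s t) /\
  (forall s u t, s \in I -> u \in I -> t \in I -> s <= u -> u <= t ->
     w s u + w u t <= w s t).

(* The limit is uniform in (s, t): it is taken along |t - s| -> 0 and not at a
   fixed point; s = t is included. *)
Definition is_regular (R : realType) (I : interval R) (w : R -> R -> R) : Prop :=
  forall e, 0 < e -> exists2 d, 0 < d &
    forall s t, s \in I -> t \in I -> s <= t -> `|t - s| < d -> `|w s t| < e.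

Definition gronwall_alpha (R : realType) (C L kappa : R) : R :=
  Num.min 1 (1 / (L * (2 * C * expR 1 ^+ 2) `^ kappa)).

(* Main.v *)
Require Import Defs.
From HB Require Import structures.
From mathcomp Require Import all_boot all_order all_algebra.
From mathcomp Require Import all_classical all_reals all_analysis.
From mathcomp Require Import ring lra.
Import Order.TTheory GRing.Theory Num.Theory.
Local Open Scope classical_set_scope.
Local Open Scope ring_scope.

(** Write [b = alpha * L] and [y t = w1 0 t / b], and let [M] be the least
constant with [G t <= M * expR (y t)] on [[0, T]].  The choice of [alpha] makes
every increment over [s <= t] with [w1 s t <= b] at most
[M / (2 e^2) * expR (y t) + w2 s t] ([gronwall_alpha_powR]).  Summing such
increments along a chain from [0] to [t] yields
[G t <= G 0 + M / 2 * expR (y t) + w2 0 t] ([chain_bound]), hence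
[M <= G 0 + S + M / 2] where [S] is the supremum on the right-hand side of the
theorem, so that [M <= 2 * (G 0 + S)].

Regularity does not make [t |-> w1 0 t] continuous, because a superadditive
[w1] may have [w1 0 t - w1 0 s] much larger than [w1 s t]; times at which
[w1 0 t] equals a given multiple of [b] therefore need not exist.  Instead the
sum over the chain is controlled by strong induction along a grid fine enough
for consecutive points to be at [w1]-distance at most [b].  From a grid point
[p n] one goes back to the first [p j] with [w1 (p j) (p n) <= b], and then to
[p (j - 1)]: superadditivity and [w1 (p (j - 1)) (p n) > b] make [y] drop by at least
[1] over these two steps, so the exponential factors sum as a geometric
series. *)

Section Control.
Context {R : realType} {T : R} {w : R -> R -> R}.
Hypothesis cw : is_control `[0, T] w.

Lemma control_ge0 {s t} : 0 <= s -> s <= t -> t <= T -> 0 <= w s t.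
Proof.
move=> s0 st tT; apply: cw.1; rewrite ?in_itv /= ?s0 ?tT ?(le_trans s0) //.
by rewrite (le_trans st).
Qed.

Lemma control_superadd {s u t} : 0 <= s -> s <= u -> u <= t -> t <= T ->
  w s u + w u t <= w s t.
Proof.
move=> s0 su ut tT; have u0 := le_trans s0 su; have uT := le_trans ut tT.
apply: cw.2; rewrite ?in_itv /= ?s0 ?u0 ?uT ?tT ?(le_trans u0) //.
by rewrite (le_trans su).
Qed.

Lemma control_ler {s u t} : 0 <= s -> s <= u -> u <= t -> t <= T ->
  w s u <= w s t.
Proof.
move=> s0 su ut tT; apply: le_trans (control_superadd s0 su ut tT).
by rewrite lerDl control_ge0// (le_trans s0).
Qed.

End Control.

Lemma gronwall_alpha_gt0 {R : realType} {C L : R} (kappa : R) :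
  0 < C -> 0 < L -> 0 < gronwall_alpha C L kappa.
Proof.
move=> C0 L0; rewrite lt_min ltr01 /= divr_gt0// mulr_gt0// powR_gt0//.
by rewrite !mulr_gt0// exprn_gt0// expR_gt0.
Qed.

(** What the second term of the minimum defining [alpha] is for; the first one
gives [alpha * L <= L]. *)
Lemma gronwall_alpha_powR {R : realType} {C L kappa : R} :
  0 < C -> 0 < L -> 1 <= kappa ->
  C * (gronwall_alpha C L kappa * L) `^ (1 / kappa) <= (2 * expR 1 ^+ 2)^-1.
Proof.
move=> C0 L0 k1; have k0 : 0 < kappa by rewrite (lt_le_trans ltr01).
have a0 := gronwall_alpha_gt0 kappa C0 L0.
set A := 2 * C * expR 1 ^+ 2.
have e0 : 0 < expR (1 : R) by exact: expR_gt0.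
have A0 : 0 < A by rewrite !mulr_gt0// exprn_gt0.
have Ak : 0 < A `^ kappa by rewrite powR_gt0.
have aL : gronwall_alpha C L kappa * L <= A `^ (- kappa).
  rewrite powRN.
  apply: (@le_trans _ _ (1 / (L * A `^ kappa) * L)).
    by rewrite ler_pM2r// ge_min lexx orbT.
  by rewrite div1r invfM mulrAC mulVf ?mul1r ?gt_eqF.
have : (gronwall_alpha C L kappa * L) `^ (1 / kappa) <= A^-1.
  have -> : A^-1 = (A `^ (- kappa)) `^ (1 / kappa).
    by rewrite -powRrM div1r mulNr mulfV ?gt_eqF// powR_inv1// ltW.
  apply: ge0_ler_powR => //.
  - by rewrite divr_ge0// ltW.
  - by rewrite nnegrE mulr_ge0// ltW.
  - by rewrite nnegrE powR_ge0.
move=> /(ler_wpM2l (ltW C0)) /le_trans; apply.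
by rewrite /A -mulrA mulrCA invfM mulrA mulfV ?mul1r// gt_eqF.
Qed.

(** The witness is the grid of a mesh given by regularity, truncated at [t]: it
remains equal to [t] once it has reached it. *)
Lemma regular_grid {R : realType} {T : R} {w : R -> R -> R} {b t : R} :
  is_regular `[0, T] w -> 0 < b -> 0 <= t -> t <= T ->
  exists p : nat -> R, exists n : nat,
    [/\ p 0 = 0, p n = t, forall i j, (i <= j)%N -> p i <= p j,
        forall i, 0 <= p i <= T & forall i, w (p i) (p i.+1) <= b].
Proof.
move=> rw b0 t0 tT; have [d d0 wd] := rw _ b0.
have h0 : 0 < d / 2 by rewrite divr_gt0.
pose p i : R := Num.min (i%:R * (d / 2)) t.
have pm i j : (i <= j)%N -> p i <= p j.
  move=> ij; rewrite /p le_min !ge_min lexx orbT andbT.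
  by rewrite ler_pM2r// ler_nat ij.
have pT i : 0 <= p i <= T.
  by rewrite /p le_min t0 andbT ge_min tT orbT andbT mulr_ge0// ltW.
exists p, (Num.bound (t / (d / 2))); split => //.
- by rewrite /p mul0r; apply/min_idPl.
- rewrite /p; apply/min_idPr; rewrite -ler_pdivrMr// ltW//.
  by apply: le_lt_trans (archi_boundP _); rewrite ?divr_ge0// ltW.
- move=> i; apply: ltW; apply: le_lt_trans (ler_norm _) _.
  apply: wd; rewrite ?in_itv //= ?pm//.
  rewrite ger0_norm ?subr_ge0 ?pm// /p -natr1 mulrDl mul1r.
  by rewrite /Num.min; do 2 case: ifP => ?; lra.
Qed.

(** Removes the smallness condition [w1 s t <= b] from the increments starting
at [s = 0], at the cost of raising the coefficient of [M] from [1 / (2 e^2)] to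
[1 / 2].  The induction closes because the last two steps contribute at most
[2 / (2 e^2)] and the earlier ones at most [1 / (2 e)], and
[1 / (2 e) + 2 / (2 e^2) <= 1 / 2]. *)
Lemma chain_bound {R : realType} {T b M : R} {G : R -> R} {w1 w2 : R -> R -> R}
    (y := fun t => w1 0 t / b) :
  0 < b -> 0 <= M ->
  is_control `[0, T] w1 -> is_control `[0, T] w2 -> is_regular `[0, T] w1 ->
  (forall s t, 0 <= s -> s <= t -> t <= T -> w1 s t <= b ->
    G t <= G s + M / (2 * expR 1 ^+ 2) * expR (y t) + w2 s t) ->
  forall t, 0 <= t -> t <= T -> G t <= G 0 + M / 2 * expR (y t) + w2 0 t.
Proof.
move=> b0 M0 c1 c2 r1 step t t0 tT.
have [p [n [p0 <- pm pT wp]]] := regular_grid r1 b0 t0 tT.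
have p_ge0 i : 0 <= p i by case/andP: (pT i).
have p_leT i : p i <= T by case/andP: (pT i).
have yle i j : (i <= j)%N -> expR (y (p i)) <= expR (y (p j)).
  by move=> ij; rewrite ler_expR ler_pM2r ?invr_gt0// (control_ler c1)// pm.
have e2 : 2 <= expR (1 : R) by have := expR_ge1Dx (1 : R); lra.
set q := M / (2 * expR 1 ^+ 2) in step.
have Mq : M / 2 = q * expR 1 ^+ 2.
  by rewrite /q; field; rewrite gt_eqF// expR_gt0.
have q0 : 0 <= q by rewrite divr_ge0// mulr_ge0// exprn_ge0// ltW// expR_gt0.
elim/ltn_ind: n => -[|m] IH.
  rewrite p0 -addrA lerDl addr_ge0//.
    by rewrite mulr_ge0 ?expR_ge0// divr_ge0.
  by rewrite (control_ge0 c2) ?(le_trans t0 tT).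
have exj : exists j, (j <= m)%N && (w1 (p j) (p m.+1) <= b).
  by exists m; rewrite leqnn wp.
have {exj} [j /andP[jm wj] jmin] := ex_minnP exj.
have sj := step _ _ (p_ge0 j) (pm _ _ (leqW jm)) (p_leT m.+1) wj.
set E := expR (y (p m.+1)) in sj *; have E0 : 0 < E by exact: expR_gt0.
rewrite Mq; case: j => [|i] in jm wj jmin sj *.
  rewrite p0 in sj; apply: (le_trans sj).
  by rewrite lerD2r lerD2l ler_pM2r// ler_peMr//; nra.
(* minimality of [j = i.+1]: [y] gains at least [1] from [p i] to [p m.+1] *)
have wi : b < w1 (p i) (p m.+1).
  rewrite ltNge; apply/negP => wi; have := jmin i.
  by rewrite wi (ltnW jm) ltnn => /(_ isT).
have si := step _ _ (p_ge0 i) (pm _ _ (leqnSn i)) (p_leT i.+1) (wp i).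
have yi : expR 1 * expR (y (p i)) <= E.
  rewrite -expRD ler_expR -(ler_pM2r b0) mulrDl mul1r !divfK ?gt_eqF//.
  have pim := pm _ _ (leqW (ltnW jm)).
  by have := control_superadd c1 (lexx 0) (p_ge0 i) pim (p_leT m.+1); lra.
have := IH i (leqW jm); rewrite Mq => Gi.
have yj : expR (y (p i.+1)) <= E by apply: yle; exact: leqW.
have pij := pm _ _ (leqnSn i); have pjm := pm _ _ (leqW jm).
have wij := control_superadd c2 (lexx 0) (p_ge0 i) pij (p_leT i.+1).
have wjm := control_superadd c2 (lexx 0) (p_ge0 i.+1) pjm (p_leT m.+1).
have q1 := ler_wpM2l q0 yj.
have q2 : q * expR 1 ^+ 2 * expR (y (p i)) <= q * expR 1 * E.
  rewrite expr2 mulrA -[leLHS]mulrA ler_wpM2l// mulr_ge0// ltW// expR_gt0.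
have q3 : q * expR 1 * E + q * E + q * E <= q * expR 1 ^+ 2 * E.
  rewrite -!mulrDl ler_pM2r// -[X in _ + X + X]mulr1 -!mulrDr ler_wpM2l//.
  by nra.
lra.
Qed.

(* [hGb] says that the suprema of G in the statement are finite real numbers
   (the real-valued [sup] is only meaningful for bounded sets). *)
Theorem lemma2p11 (R : realType) (T : R) (hT : 0 < T) (G : R -> R)
  (hG : forall t, t \in `[0, T] -> 0 <= G t)
  (hGb : has_ubound [set G r | r in `[0, T]])
  (C L kappa : R) (hC : 0 < C) (hL : 0 < L) (hkappa : 1 <= kappa)
  (w1 w2 : R -> R -> R)
  (hw1 : is_control `[0, T] w1) (hw2 : is_control `[0, T] w2)
  (hw1r : is_regular `[0, T] w1)
  (hincr : forall s t, s \in `[0, T] -> t \in `[0, T] -> s < t ->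
     w1 s t <= L ->
     increment G s t <=
       C * sup [set G r | r in `[0, t]] * w1 s t `^ (1 / kappa) + w2 s t) :
  let alpha := gronwall_alpha C L kappa in
  sup [set G t | t in `[0, T]] <=
    2 * expR (w1 0 T / (alpha * L)) *
    (G 0 + sup [set w2 0 t * expR (- (w1 0 t / (alpha * L))) | t in `[0, T]]).
Proof.
cbv zeta; set b := gronwall_alpha C L kappa * L; pose y t := w1 0 t / b.
have b0 : 0 < b by rewrite mulr_gt0// gronwall_alpha_gt0.
have bL : b <= L by rewrite ler_piMl ?(ltW hL)// ge_min lexx.
have T0 := ltW hT.
have G0 t : 0 <= t -> t <= T -> 0 <= G t.
  by move=> t0 tT; apply: hG; rewrite in_itv/= t0.
have y_ge0 t : 0 <= t -> t <= T -> 0 <= y t.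
  by move=> t0 tT; rewrite divr_ge0 ?(control_ge0 hw1)// ltW.
have yle s t : 0 <= s -> s <= t -> t <= T -> expR (y s) <= expR (y t).
  by move=> *; rewrite ler_expR ler_pM2r ?invr_gt0// (control_ler hw1).
have yN t : 0 <= t -> t <= T -> expR (- y t) <= 1.
  by move=> t0 tT; rewrite expR_le1 oppr_le0 y_ge0.
set S := sup [set w2 0 t * expR (- y t) | t in `[0, T]].
have w2S t : 0 <= t -> t <= T -> w2 0 t <= S * expR (y t).
  move=> t0 tT; rewrite -ler_pdivrMr ?expR_gt0// -expRN.
  apply: ub_le_sup; last by exists t => //=; rewrite in_itv/= t0.
  exists (w2 0 T) => _ [r + <-]; rewrite /= in_itv/= => /andP[r0 rT].
  apply: (@le_trans _ _ (w2 0 r)); last exact: (control_ler hw2).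
  by rewrite ler_piMr ?yN// (control_ge0 hw2).
set M := sup [set G t * expR (- y t) | t in `[0, T]].
have GM t : 0 <= t -> t <= T -> G t <= M * expR (y t).
  move=> t0 tT; rewrite -ler_pdivrMr ?expR_gt0// -expRN.
  apply: ub_le_sup; last by exists t => //=; rewrite in_itv/= t0.
  have [B BG] := hGb; exists B => _ [r + <-].
  rewrite /= in_itv/= => /andP[r0 rT].
  apply: (@le_trans _ _ (G r)); last first.
    by apply: BG; exists r; rewrite //= in_itv/= r0.
  by rewrite ler_piMr ?yN// G0.
have M0 : 0 <= M.
  by rewrite -(pmulr_lge0 _ (expR_gt0 (y 0))) (le_trans (G0 0 _ _) (GM 0 _ _)).
have S0 : 0 <= S.
  rewrite -(pmulr_lge0 _ (expR_gt0 (y 0))) (le_trans _ (w2S 0 _ _))//.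
  exact: (control_ge0 hw2).
(* [y] is nondecreasing, so the bound on [G] passes to its running supremum *)
have Gsup t : 0 <= t -> t <= T ->
    sup [set G r | r in `[0, t]] <= M * expR (y t).
  move=> t0 tT; apply: ge_sup.
    by exists (G 0), 0; rewrite //= in_itv/= lexx.
  move=> _ [r + <-]; rewrite /= in_itv/= => /andP[r0 rt].
  apply: le_trans (GM _ r0 (le_trans rt tT)) _.
  by rewrite ler_wpM2l// yle.
have step s t : 0 <= s -> s <= t -> t <= T -> w1 s t <= b ->
    G t <= G s + M / (2 * expR 1 ^+ 2) * expR (y t) + w2 s t.
  move=> s0 st tT wb; have w0 := control_ge0 hw1 s0 st tT.
  have t0 := le_trans s0 st.
  rewrite -addrA -lerBlDl.
  have [ts|nst] := eqVneq t s.
    rewrite ts in tT *.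
    rewrite subrr addr_ge0 ?(control_ge0 hw2)// mulr_ge0 ?expR_ge0//.
    by rewrite divr_ge0// mulr_ge0// exprn_ge0// expR_ge0.
  have lst : s < t by rewrite lt_neqAle eq_sym nst.
  have sI : s \in `[0, T] by rewrite in_itv/= s0 (le_trans st).
  have tI : t \in `[0, T] by rewrite in_itv/= t0.
  apply: le_trans (hincr _ _ sI tI lst (le_trans wb bL)) _; rewrite lerD2r.
  rewrite [leRHS]mulrAC [leRHS]mulrC [leLHS]mulrAC.
  have alpha_powR := gronwall_alpha_powR hC hL hkappa.
  apply: ler_pM; rewrite ?Gsup//.
  - by rewrite mulr_ge0 ?powR_ge0// ltW.
  - apply: le_trans (G0 0 (lexx 0) T0) _; apply: ub_le_sup.
      have [B BG] := hGb; exists B => _ [r + <-].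
      rewrite /= in_itv/= => /andP[r0 rt]; apply: BG.
      by exists r; rewrite //= in_itv/= r0 (le_trans rt).
    by exists 0; rewrite //= in_itv/= lexx.
  apply: le_trans alpha_powR; rewrite ler_wpM2l ?(ltW hC)//.
  apply: ge0_ler_powR; rewrite ?nnegrE// ?(ltW b0)//.
  by rewrite divr_ge0// (le_trans ler01).
have MGS : M <= G 0 + S + M / 2.
  apply: ge_sup.
    by exists (G 0 * expR (- y 0)), 0; rewrite //= in_itv/= lexx.
  move=> _ [r + <-]; rewrite /= in_itv/= => /andP[r0 rT].
  rewrite expRN ler_pdivrMr ?expR_gt0//.
  apply: le_trans (chain_bound b0 M0 hw1 hw2 hw1r step _ r0 rT) _.
  have := w2S r r0 rT; have : G 0 <= G 0 * expR (y r).
    by rewrite ler_peMr ?G0// -[leLHS]expR0 ler_expR y_ge0.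
  rewrite !mulrDl -/(y r); lra.
apply: le_trans (Gsup T T0 (lexx T)) _.
rewrite mulrAC ler_pM2r ?expR_gt0//; lra.
Qed.
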